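(* Let $(X,\varphi)$ be a Cantor minimal system and let $g\in[\varphi]$ be an involution with clopen support. Then $g$ is a product of $10$ commutators in $[\varphi]$.
   Context: A Cantor set is a (non-empty) zero-dimensional compact metric space without isolated points. $H(X)$ is the group of all homeomorphisms of $X$. A Cantor minimal system $(X,\varphi)$ is a Cantor set $X$ with $\varphi\in H(X)$ such that every orbit $Orb_\varphi(x)=\{\varphi^n(x):n\in\mathbb Z\}$ is dense in $X$. The full group $[\varphi]$ is the set of all $f\in H(X)$ with $f(x)\in Orb_\varphi(x)$ for all $x\in X$. The support of $f\in H(X)$ is $supp(f)=\{x\in X:f(x)\neq x\}$. An involution is an element $g$ with $g^2=id$. A commutator in $[\varphi]$ is an element $[a,b]=aba^{-1}b^{-1}$ with $a,b\in[\varphi]$. *)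

(* Defs.v *)
From HB Require Import structures.
From mathcomp Require Import all_boot all_order all_algebra.
From mathcomp Require Import boolp classical_sets reals topology cantor.

Set Implicit Arguments.
Unset Strict Implicit.
Unset Printing Implicit Defensive.

Local Open Scope classical_set_scope.
Local Open Scope group_scope.

(* The inverse is stored as data; it is determined by the underlying map, so
   equality of homeomorphisms is pointwise equality (homeoP). *)
Record homeo (X : topologicalType) := Homeo {
  homeo_fun :> X -> X;
  homeo_inv : X -> X;
  homeo_continuous : continuous homeo_fun;
  homeo_inv_continuous : continuous homeo_inv;
  homeoK : cancel homeo_fun homeo_inv;
  homeoVK : cancel homeo_inv homeo_fun }.

Lemma homeoP (X : topologicalType) (f g : homeo X) : f =1 g -> f = g.
Proof.
case: f g => [f f' cf cf' fK fVK] [g g' cg cg' gK gVK] /= /funext fg.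
move: cg gK gVK; rewrite -fg => cg gK gVK.
have fg' : f' = g' by apply/funext => x; rewrite -[in LHS](gVK x) fK.
move: cg' gK gVK; rewrite -fg' => cg' gK gVK.
by congr Homeo; exact: Prop_irrelevance.
Qed.

Section HomeoGroup.
Variable X : topologicalType.
Implicit Types f g h : homeo X.

Lemma continuous_id_fun : continuous (@idfun X).
Proof. by move=> x. Qed.

Lemma continuous_comp_fun (u v : X -> X) :
  continuous u -> continuous v -> continuous (u \o v).
Proof. by move=> cu cv x; apply: continuous_comp; [exact: cv|exact: cu]. Qed.

Definition homeo_id : homeo X :=
  Homeo continuous_id_fun continuous_id_fun (frefl _) (frefl _).

Definition homeo_comp f g : homeo X :=
  Homeo (continuous_comp_fun (@homeo_continuous _ f) (@homeo_continuous _ g))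
    (continuous_comp_fun (@homeo_inv_continuous _ g)
       (@homeo_inv_continuous _ f))
    (can_comp (@homeoK _ f) (@homeoK _ g))
    (can_comp (@homeoVK _ g) (@homeoVK _ f)).

Definition homeo_sym f : homeo X :=
  Homeo (@homeo_inv_continuous _ f) (@homeo_continuous _ f)
    (@homeoVK _ f) (@homeoK _ f).

Lemma homeo_compA : associative homeo_comp.
Proof. by move=> f g h; exact: homeoP. Qed.

Lemma homeo_comp1f : left_id homeo_id homeo_comp.
Proof. by move=> f; exact: homeoP. Qed.

Lemma homeo_compf1 : right_id homeo_id homeo_comp.
Proof. by move=> f; exact: homeoP. Qed.

Lemma homeo_compVf : left_inverse homeo_id homeo_sym homeo_comp.
Proof. by move=> f; apply: homeoP => x; exact: homeoK. Qed.

Lemma homeo_compfV : right_inverse homeo_id homeo_sym homeo_comp.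
Proof. by move=> f; apply: homeoP => x; exact: homeoVK. Qed.

HB.instance Definition _ := gen_eqMixin (homeo X).
HB.instance Definition _ := gen_choiceMixin (homeo X).
(* H(X) is a group for composition: (f * g) x = f (g x). *)
HB.instance Definition _ := isGroup.Build (homeo X)
  homeo_compA homeo_comp1f homeo_compf1 homeo_compVf homeo_compfV.

Lemma homeo1E x : (1 : homeo X) x = x. Proof. by []. Qed.

Lemma homeoME f g x : (f * g) x = f (g x). Proof. by []. Qed.

Lemma homeoVE f x : f^-1 x = homeo_inv f x. Proof. by []. Qed.

End HomeoGroup.

Definition zpowg (G : groupType) (x : G) (n : int) : G :=
  match n with
  | Posz m => x ^+ m
  | Negz m => x ^- m.+1
  end.

Definition Orb (X : topologicalType) (phi : homeo X) (x : X) : set X :=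
  [set zpowg phi n x | n in [set: int]].

(* cantor_like does not exclude the empty space. *)
Definition cantor_set (R : realType) (X : metricType R) : Prop :=
  [set: X] !=set0 /\ cantor_like X.

Definition cantor_minimal_system (R : realType) (X : metricType R)
    (phi : homeo X) : Prop :=
  cantor_set X /\ forall x : X, dense (Orb phi x).

Definition full_group (X : topologicalType) (phi : homeo X) :
    set (homeo X) :=
  [set f | forall x : X, Orb phi x (f x)].

Definition supp (X : topologicalType) (f : homeo X) : set X :=
  [set x | f x <> x].

Definition involution (G : groupType) (g : G) : Prop := g ^+ 2 = 1.

(* This is not MathComp's [~ a, b], which is a^-1 * b^-1 * a * b. *)
Definition commutator (G : groupType) (a b : G) : G :=
  a * b * a^-1 * b^-1.

Definition product_of_commutators (G : groupType) (H : set G) (n : nat)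
    (g : G) : Prop :=
  exists a b : 'I_n -> G,
    (forall i, H (a i) /\ H (b i)) /\
    g = \prod_(i < n) commutator (a i) (b i).

(* Main.v *)
Require Import Defs.
From mathcomp Require Import all_boot all_order all_algebra.
From mathcomp Require Import boolp classical_sets reals topology cantor.

Set Implicit Arguments.
Unset Strict Implicit.
Unset Printing Implicit Defensive.

Local Open Scope classical_set_scope.
Local Open Scope group_scope.

(** Let g be an involution with clopen support.  Compactness gives a clopen A
    such that supp g is the disjoint union of A and g(A), so that g is the
    exchange [swap A g] of A with its image under g.  Everything is written in
    terms of such exchanges.

    The source of commutators is the identity
    [swap A f * swap (k(A)) g = commutator (swap A f) k], valid when k conjugates
    f on A to g on k(A) ([swap_pair_commutator]): two equivalent exchanges with
    disjoint supports multiply to a commutator.  A single exchange [swap A g] is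
    therefore a commutator as soon as A splits into two halves that an element of
    the full group interchanges.  Such halves need not exist, but minimality
    provides them up to an error as small as one likes
    ([pairing_up_to_small]): given any non-empty clopen U, one can pair off a part
    of A with another part of A so that the remainder C can be moved into U by an
    element of the full group.  This replaces the usual comparison of clopen sets
    by invariant measures.  Since the error C can be moved into any prescribed
    non-empty open set W disjoint from supp g, the exchange of C with g(C) is
    conjugate to an exchange g' supported in W, and g * g' is a product of two
    commutators ([compress_involution]).

    Iterating in disjoint open sets that shrink to a point p gives involutions
    s_0 = g, s_1, s_2, ... with disjoint supports converging to p, such that each
    s_n * s_(n+1) is a product of two commutators supported on
    supp s_n U supp s_(n+1).  Elements of the full group supported on disjoint
    clopen sets shrinking to a point can be glued into one element of the full
    group, and gluing commutes with products and inverses.  Hence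
    (s_0 s_1)(s_2 s_3)... and (s_1 s_2)(s_3 s_4)... are products of two
    commutators each ([compressing_product]), and their product is s_0
    ([compressing_head]).

    This needs a point p outside supp g, which is arranged at the cost of one
    commutator by first splitting off a small part of g ([shrink_involution]).
    Altogether g is a product of 1 + 2 + 2 = 5 commutators, and trivial ones make
    up the number 10. *)

(** * Integer powers *)

Section IntegerPowers.
Variables (G : groupType) (x : G).

Lemma zpowg_succ (n : int) : zpowg x (1 + n)%R = x * zpowg x n.
Proof.
case: n => [n|[|n]]; first by rewrite -intS /= expgS.
- by rewrite NegzE GRing.subrr /= mulgV.
- have -> : (1 + Negz n.+1)%R = Negz n.
    by rewrite !NegzE [in LHS]intS GRing.opprD GRing.addrA GRing.subrr GRing.add0r.
  by rewrite /= [in RHS]expgSr invgM mulVKg.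
Qed.

Lemma zpowg_pred (n : int) : zpowg x (n - 1)%R = x^-1 * zpowg x n.
Proof.
have -> : zpowg x n = x * zpowg x (n - 1)%R.
  by rewrite -zpowg_succ GRing.addrC GRing.subrK.
by rewrite mulKg.
Qed.

Lemma zpowgD (m n : int) : zpowg x (m + n)%R = zpowg x m * zpowg x n.
Proof.
elim: m => [|m IHm|m IHm]; first by rewrite GRing.add0r mul1g.
- by rewrite intS -GRing.addrA !zpowg_succ IHm mulgA.
- have -> : (- m.+1%:Z)%R = (- m%:Z - 1)%R by rewrite intS GRing.opprD GRing.addrC.
  by rewrite -GRing.addrA [(-1 + n)%R]GRing.addrC GRing.addrA !zpowg_pred IHm mulgA.
Qed.

Lemma zpowgN (n : int) : zpowg x (- n)%R = (zpowg x n)^-1.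
Proof.
by apply/esym/mulg1_eq; rewrite -zpowgD GRing.subrr.
Qed.

End IntegerPowers.

(** * Homeomorphisms and their supports *)

Section Homeomorphisms.
Variable X : topologicalType.
Implicit Types (f g h k s : homeo X) (A B U V Y : set X).

Lemma homeoVf f x : f^-1 (f x) = x. Proof. exact: homeoK. Qed.
Lemma homeofV f x : f (f^-1 x) = x. Proof. exact: homeoVK. Qed.

Lemma homeo_inj f : injective f.
Proof. exact: can_inj (homeoVf f). Qed.

Lemma homeo_image f A x : (f @` A) x <-> A (f^-1 x).
Proof.
split=> [[y Ay <-]|Afx]; first by rewrite homeoVf.
by exists (f^-1 x) => //; rewrite homeofV.
Qed.

Lemma clopen_homeo_preimage f A : clopen A -> clopen (f @^-1` A).
Proof. by move=> cA; apply: preimage_clopen => //; exact: homeo_continuous. Qed.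

Lemma clopen_homeo_image f A : clopen A -> clopen (f @` A).
Proof.
move=> /(clopen_homeo_preimage f^-1).
by congr clopen; apply/seteqP; split=> x /homeo_image.
Qed.

Lemma clopenD A B : clopen A -> clopen B -> clopen (A `\` B).
Proof. by move=> cA cB; rewrite setDE; apply: clopenI => //; apply: clopenC. Qed.

Lemma continuous_clopen_if A (u v : X -> X) :
  clopen A -> continuous u -> continuous v ->
  continuous (fun x => if `[<A x>] then u x else v x).
Proof.
move=> [oA cA] cu cv x; rewrite /continuous_at.
have [Ax|nAx] := pselect (A x).
- rewrite asboolT//; apply: cvg_trans (cu x); apply: near_eq_cvg.
  by apply: filterS (open_nbhs_nbhs (conj oA Ax)) => y Ay /=; rewrite asboolT.
- rewrite asboolF//; apply: cvg_trans (cv x); apply: near_eq_cvg.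
  have nA : nbhs x (~` A) by apply: open_nbhs_nbhs; split=> //; apply: closed_openC.
  by apply: filterS nA => y nAy /=; rewrite asboolF.
Qed.

Lemma involutionP s : involution s <-> forall x, s (s x) = x.
Proof.
rewrite /involution expg2; split=> [ss x|ss].
- by rewrite -homeoME ss.
- by apply: homeoP => x; rewrite homeoME ss.
Qed.

Lemma involutionV s : involution s -> s^-1 = s.
Proof. by rewrite /involution expg2 => /mulg1_eq. Qed.

Lemma supp_homeo f x : supp f (f x) <-> supp f x.
Proof. by split=> /= + fx; apply; [rewrite fx|apply: homeo_inj fx]. Qed.

Lemma supp_fixed f x : ~ supp f x -> f x = x.
Proof. by move=> /contrapT. Qed.

Lemma supp_homeoM f g : supp (f * g) `<=` supp f `|` supp g.
Proof.
move=> x fgx; have [gx|/supp_fixed gx] := pselect (supp g x); first by right.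
by left=> fx; apply: fgx; rewrite homeoME gx.
Qed.

Lemma supp_homeoV f : supp f^-1 `<=` supp f.
Proof. by move=> x fVx fx; apply: fVx; rewrite -{1}fx homeoVf. Qed.

(** * Exchanging two disjoint clopen sets *)

Definition displaced A f := clopen A /\ forall x, A x -> ~ A (f x).

Definition swap_fun A f x :=
  if `[<A x>] then f x else if `[<A (f^-1 x)>] then f^-1 x else x.

(** The homeomorphism with graph [swap_fun A f], which exists when A is displaced
    by f; choosing it by its graph spares every use of [swap] a proof argument. *)
Definition swap A f : homeo X := xget 1 [set s : homeo X | s =1 swap_fun A f].

Lemma swapE A f : displaced A f -> swap A f =1 swap_fun A f.
Proof.
move=> [cA dA].
have K x : swap_fun A f (swap_fun A f x) = x.
  rewrite /swap_fun; have [Ax|nAx] := pselect (A x).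
    by rewrite (asboolT Ax) (asboolF (dA _ Ax)) homeoVf asboolT.
  rewrite (asboolF nAx); have [Afx|nAfx] := pselect (A (f^-1 x)).
    by rewrite (asboolT Afx) (asboolT Afx) homeofV.
  by rewrite (asboolF nAfx) !asboolF.
have C : continuous (swap_fun A f).
  apply: continuous_clopen_if => //; first exact: homeo_continuous.
  apply: (@continuous_clopen_if (f^-1 @^-1` A) f^-1 idfun).
  - exact: clopen_homeo_preimage.
  - exact: homeo_continuous.
  - exact: continuous_id_fun.
by rewrite /swap; case: xgetP => // /(_ (Homeo C C K K))[].
Qed.

Lemma swap_in A f x : displaced A f -> A x -> swap A f x = f x.
Proof. by move=> dA Ax; rewrite swapE// /swap_fun asboolT. Qed.

Lemma swap_image A f x : displaced A f -> A x -> swap A f (f x) = x.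
Proof.
by move=> dA Ax; rewrite swapE// /swap_fun homeoVf asboolF ?asboolT//; apply: dA.2.
Qed.

Lemma swap_out A f x : displaced A f -> ~ A x -> ~ (f @` A) x -> swap A f x = x.
Proof.
by move=> dA nAx /homeo_image nAf; rewrite swapE// /swap_fun !asboolF.
Qed.

(** Case analysis on the position of x relative to A and f(A); the image case
    is phrased through the preimage y of x, which is also the value at x. *)
Variant swap_spec A f x : X -> Prop :=
| SwapIn of A x : swap_spec A f x (f x)
| SwapImage y of A y & x = f y : swap_spec A f x y
| SwapOut of ~ A x & ~ (f @` A) x : swap_spec A f x x.

Lemma swapP A f x : displaced A f -> swap_spec A f x (swap A f x).
Proof.
move=> dA; have [Ax|nAx] := pselect (A x).
  by rewrite swap_in//; constructor.
have [[y Ay yx]|nAf] := pselect ((f @` A) x).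
  by rewrite -{2}yx swap_image//; apply: SwapImage.
by rewrite swap_out//; constructor.
Qed.

Lemma swap_involution A f : displaced A f -> involution (swap A f).
Proof.
move=> dA; apply/involutionP => x; case: (swapP x dA) => [Ax|y Ay ->|nAx nAf].
- exact: swap_image.
- exact: swap_in.
- exact: swap_out.
Qed.

Lemma supp_swap A f : displaced A f -> supp (swap A f) = A `|` f @` A.
Proof.
move=> dA; apply/seteqP; split=> x; rewrite /supp /=.
- case: (swapP x dA) => [Ax _|y Ay -> _|_ _ ne]; [by left|by right; exists y|by case: ne].
- case=> [Ax|[y Ay <-]] sx.
  + by apply: (dA.2 x Ax); rewrite -(swap_in dA Ax) sx.
  + by apply: (dA.2 y Ay); rewrite -sx swap_image.
Qed.

Lemma eq_swap A f g : displaced A f -> (forall x, A x -> f x = g x) ->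
  swap A f = swap A g.
Proof.
move=> dA E.
have dg : displaced A g.
  by split=> [|x Ax]; [exact: dA.1|rewrite -E//; exact: dA.2].
apply: homeoP => x; case: (swapP x dA) => [Ax|y Ay ->|nAx nAf].
- by rewrite swap_in// E.
- by rewrite E// swap_image.
- rewrite swap_out// => -[y Ay yx]; apply: nAf; exists y => //.
  by rewrite E.
Qed.

Lemma swap_conj k A f : displaced A f ->
  displaced (k @` A) (k * f * k^-1) /\
  k * swap A f * k^-1 = swap (k @` A) (k * f * k^-1).
Proof.
move=> dA.
have dk : displaced (k @` A) (k * f * k^-1).
  split; first exact: clopen_homeo_image dA.1.
  move=> _ [x Ax <-] /homeo_image.
  by rewrite !homeoME !homeoVf; apply: dA.2.
split=> //; apply: homeoP => x; rewrite !homeoME.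
case: (swapP (k^-1 x) dA) => [Ax|y Ay xy|nAx nAf].
- by rewrite swap_in ?homeoME//; apply/homeo_image.
- have -> : x = (k * f * k^-1) (k y) by rewrite !homeoME homeoVf -xy homeofV.
  by rewrite swap_image//; exists y.
- rewrite homeofV swap_out// => [/homeo_image//|[_ [y Ay <-] yx]]; apply: nAf.
  by exists y => //; rewrite -yx !homeoME !homeoVf.
Qed.

Lemma displaced_sub A B f : clopen B -> B `<=` A -> displaced A f -> displaced B f.
Proof. by move=> cB BA [_ dA]; split=> // x /BA/dA nA /BA. Qed.

Lemma swapU A B f : displaced (A `|` B) f -> clopen A -> clopen B ->
  A `&` B = set0 -> swap (A `|` B) f = swap A f * swap B f.
Proof.
move=> dU cA cB AB.
have dA : displaced A f by apply: displaced_sub dU => // x; left.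
have dB : displaced B f by apply: displaced_sub dU => // x; right.
have nAB x : A x -> ~ B x by move=> Ax Bx; suff : set0 x by []; rewrite -AB.
have nAfB x : A x -> ~ (f @` B) x.
  by move=> Ax [y By yx]; apply: (dU.2 y); [right|left; rewrite yx].
have nBfA x : B x -> ~ (f @` A) x.
  by move=> Bx [y Ay yx]; apply: (dU.2 y); [left|right; rewrite yx].
have nfAfB x : (f @` A) x -> ~ (f @` B) x.
  by move=> [y Ay <-] [z Bz /homeo_inj zy]; apply: (nAB y Ay); rewrite -zy.
apply: homeoP => x; rewrite homeoME.
case: (swapP x dU) => [[Ax|Bx]|y [Ay|By] ->|nU nfU].
- by rewrite (swap_out dB (nAB x Ax) (nAfB x Ax)) swap_in.
- rewrite (swap_in dB)// swap_out//.
  + by move=> Afx; apply: (dU.2 x); [right|left].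
  + by move=> fA; apply: nfAfB fA _; exists x.
- have fAy : (f @` A) (f y) by exists y.
  have nBfy : ~ B (f y) by move=> Bfy; apply: (dU.2 y); [left|right].
  by rewrite (swap_out dB nBfy (nfAfB _ fAy)) swap_image.
- rewrite (swap_image dB)// swap_out//; last exact: nBfA.
  by move=> /nAB.
- have [nA nB] : ~ A x /\ ~ B x by split=> ?; apply: nU; [left|right].
  have [nfA nfB] : ~ (f @` A) x /\ ~ (f @` B) x.
    by split=> -[y ? yx]; apply: nfU; exists y => //; [left|right].
  by rewrite !swap_out.
Qed.

Lemma involution_eq_swap s A : involution s -> displaced A s ->
  supp s = A `|` s @` A -> s = swap A s.
Proof.
move=> /involutionP ss dA sE; apply: homeoP => x.
case: (swapP x dA) => [//|y Ay -> //|nA nsA].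
by apply: supp_fixed; rewrite sE => -[].
Qed.

(** Each factor fixes the support of the other, which the other preserves; so
    the product acts as s on supp s and as t on supp t. *)
Lemma disjoint_involutionM s t : involution s -> involution t ->
  supp s `&` supp t = set0 ->
  involution (s * t) /\ supp (s * t) = supp s `|` supp t.
Proof.
move=> /involutionP ss /involutionP tt st.
have nst x : supp s x -> ~ supp t x.
  by move=> sx tx; suff : set0 x by []; rewrite -st.
have st_s x : supp s x -> (s * t) x = s x.
  by move=> /nst/supp_fixed; rewrite homeoME => ->.
have st_t x : supp t x -> (s * t) x = t x.
  by move=> tx; rewrite homeoME; apply: supp_fixed => /nst; apply; apply/supp_homeo.
have st_o x : ~ supp s x -> ~ supp t x -> (s * t) x = x.
  by move=> sx tx; rewrite homeoME !supp_fixed.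
have stC x : supp s x \/ supp t x \/ (~ supp s x /\ ~ supp t x).
  by have [] := pselect (supp s x); have [] := pselect (supp t x); tauto.
split.
- apply/involutionP => x; have [sx|[tx|[sx tx]]] := stC x.
  + by rewrite (st_s x sx) (st_s _ ((supp_homeo s x).2 sx)) ss.
  + by rewrite (st_t x tx) (st_t _ ((supp_homeo t x).2 tx)) tt.
  + by rewrite !st_o.
- apply/seteqP; split=> x.
  + have [sx|[tx|[sx tx]]] := stC x => stx; [by left|by right|].
    by case: stx; exact: st_o.
  + by case=> [sx|tx] stx; [apply: (sx); rewrite -[RHS]stx st_s
                           |apply: (tx); rewrite -[RHS]stx st_t].
Qed.

End Homeomorphisms.

(** * The full group *)

Section FullGroup.
Variables (X : topologicalType) (phi : homeo X).
Implicit Types (f g h s : homeo X) (A U W Y : set X).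

Lemma full_zpowg (n : int) : full_group phi (zpowg phi n).
Proof. by move=> x; exists n. Qed.

Lemma full1 : full_group phi 1.
Proof. exact: (full_zpowg 0). Qed.

Lemma fullM f g : full_group phi f -> full_group phi g -> full_group phi (f * g).
Proof.
move=> ff fg x; have [m _ gx] := fg x; have [n _ fgx] := ff (g x).
by exists (n + m)%R => //; rewrite zpowgD !homeoME gx fgx.
Qed.

Lemma fullV f : full_group phi f -> full_group phi f^-1.
Proof.
move=> ff x; have [n _ fx] := ff (f^-1 x).
by exists (- n)%R => //; rewrite zpowgN -{1}(homeofV f x) -fx homeoVf.
Qed.

(** Only the orbits matter for membership in the full group, so an element
    obtained by patching elements of the full group together is still in it. *)
Lemma full_local h : (forall x, exists2 f, full_group phi f & h x = f x) ->
  full_group phi h.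
Proof. by move=> loc x; have [f ff ->] := loc x; apply: ff. Qed.

Lemma full_swap A f : full_group phi f -> displaced A f ->
  full_group phi (swap A f).
Proof.
move=> ff dA; apply: full_local => x.
case: (swapP x dA) => [Ax|y Ay ->|_ _]; first by exists f.
- by exists f^-1; [exact: fullV|rewrite homeoVf].
- by exists 1; first exact: full1.
Qed.

Definition full_within Y : set (homeo X) :=
  [set f | full_group phi f /\ supp f `<=` Y].

Lemma within_preserve f Y x : supp f `<=` Y -> Y x -> Y (f x).
Proof.
move=> fY Yx; have [fx|/supp_fixed-> //] := pselect (supp f x).
by apply: fY; apply/supp_homeo.
Qed.

Lemma within1 Y : full_within Y 1.
Proof. by split=> [|x []//]; exact: full1. Qed.

Lemma withinM Y f g : full_within Y f -> full_within Y g -> full_within Y (f * g).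
Proof.
move=> [ff fY] [fg gY]; split; first exact: fullM.
by move=> x /supp_homeoM[/fY|/gY].
Qed.

Lemma withinV Y f : full_within Y f -> full_within Y f^-1.
Proof. by move=> [ff fY]; split; [exact: fullV|move=> x /supp_homeoV/fY]. Qed.

Lemma within_swap Y A f : full_group phi f -> displaced A f ->
  A `<=` Y -> f @` A `<=` Y -> full_within Y (swap A f).
Proof.
move=> ff dA AY fAY; split; first exact: full_swap.
by rewrite supp_swap// subUset.
Qed.

Record clopen_involution s : Prop := ClopenInvolution {
  cinv_full : full_group phi s;
  cinv_involution : involution s;
  cinv_supp : clopen (supp s) }.

Lemma swap_clopen_involution A f : full_group phi f -> displaced A f ->
  clopen_involution (swap A f).
Proof.
move=> ff dA; split; [exact: full_swap|exact: swap_involution|].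
rewrite supp_swap//; apply: clopenU; first exact: dA.1.
exact/clopen_homeo_image/dA.1.
Qed.

Lemma clopen_involutionM s t : clopen_involution s -> clopen_involution t ->
  supp s `&` supp t = set0 -> clopen_involution (s * t).
Proof.
move=> [fs is_ cs] [ft it ct] /(disjoint_involutionM is_ it)[ist sst].
by split; [exact: fullM| |rewrite sst; exact: clopenU].
Qed.

End FullGroup.

(** * Products of commutators *)

Section ProductsOfCommutators.
Variable G : groupType.
Implicit Types (H : set G) (x y : G).

Lemma product_of_commutators1 H a b : H a -> H b ->
  product_of_commutators H 1 (commutator a b).
Proof.
by move=> Ha Hb; exists (fun=> a), (fun=> b); split=> //; rewrite big_ord1.
Qed.

Lemma product_of_commutatorsM H m n x y : product_of_commutators H m x ->
  product_of_commutators H n y -> product_of_commutators H (m + n) (x * y).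
Proof.
move=> [a [b [Hab ->]]] [c [d [Hcd ->]]].
pose glue (u : 'I_m -> G) (v : 'I_n -> G) (i : 'I_(m + n)) :=
  match split i with inl j => u j | inr j => v j end.
exists (glue a c), (glue b d); split=> [i|].
  by rewrite /glue; case: (split i).
rewrite big_split_ord /=; congr (_ * _); apply: eq_bigr => i _.
- by rewrite /glue (unsplitK (inl i)).
- by rewrite /glue (unsplitK (inr i)).
Qed.

Lemma product_of_commutators_one H n : H 1 -> product_of_commutators H n 1.
Proof.
move=> H1; exists (fun=> 1), (fun=> 1); split=> //.
by rewrite big1// => i _; rewrite /commutator !invg1 !mulg1.
Qed.

End ProductsOfCommutators.

(** * Clopen sets in Cantor spaces *)

Section CompactInduction.
Variable X : topologicalType.

(** Compactness as an induction principle: a property of sets that can be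
    enlarged by some neighbourhood of each point holds for a finite union of
    these neighbourhoods that covers the space. *)
Lemma compact_union_ind (P : set X -> Prop) : compact [set: X] -> P set0 ->
  (forall x : X, exists2 V, nbhs x V & forall K, P K -> P (K `|` V)) -> P setT.
Proof.
move=> cX P0 locP.
pose good V := forall K, P K -> P (K `|` V).
(* The sets that contain some good V form a filter, since the good sets are
   stable under unions; the near-covering form of compactness applies to it. *)
pose F : set_system (set X) := filter_from good (fun V => [set D | V `<=` D]).
have FF : Filter F.
  apply: filter_from_filter; first by exists set0 => K; rewrite setU0.
  move=> V W gV gW; exists (V `|` W); first by move=> K PK; rewrite setUA; apply/gW/gV.
  by move=> D VWD; split=> x ?; apply: VWD; [left|right].
have /(_ _ F (fun D x => D x) FF) := (compact_near_coveringP _).1 cX.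
case=> [x _|V gV /(_ V (@subset_refl _ _)) TV].
  have [V xV gV] := locP x; exists (V, [set D | V `<=` D]); first split => //=.
    by exists V.
  by move=> [y D] /= [Vy VD]; apply: VD.
by have -> : setT = set0 `|` V; [rewrite set0U; apply/seteqP; split|apply: gV].
Qed.

End CompactInduction.

Section CantorSpace.
Variable X : topologicalType.
Hypothesis cantorX : cantor_like X.
Implicit Types (f g h s : homeo X) (A U V W : set X).

Let perfectX : perfect_set [set: X]. Proof. by case: cantorX. Qed.
Let compactX : compact [set: X]. Proof. by case: cantorX. Qed.
Let hausdorffX : hausdorff_space X. Proof. by case: cantorX. Qed.
Let zerodimX : zero_dimensional X. Proof. by case: cantorX. Qed.

Lemma clopen_nbhs x U : nbhs x U -> exists V, [/\ clopen V, V x & V `<=` U].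
Proof.
move=> xU; have /(_ x _ xU) := zero_dimensional_cvg hausdorffX zerodimX compactX.
by move=> [V [Vx cV] VU]; exists V.
Qed.

Lemma punctured_open W x : open W -> W x ->
  open (W `\ x) /\ W `\ x !=set0.
Proof.
move=> oW Wx; split.
  rewrite setDE; apply: openI => //; apply: closed_openC.
  exact/accessible_closed_set1/hausdorff_accessible.
have [y [z [Wy Wz yz]]] := (perfectTP_ex.1 perfectX) W oW (ex_intro _ x Wx).
have [yx|/eqP yx] := eqVneq y x; last by exists y.
by exists z; split=> // zx; move: yz; rewrite yx zx eqxx.
Qed.

(** Separate x from f x by a clopen V and keep the points of V that f moves
    out of V. *)
Lemma displaced_nbhs f x W : f x <> x -> nbhs x W ->
  exists U, [/\ U x, U `<=` W & displaced U f].
Proof.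
move=> fx xW; have [U0 [cU0 U0x U0W]] := clopen_nbhs xW.
have /zerodimX[V [cV Vx nVfx]] : x != f x by apply/eqP => /esym.
exists (U0 `&` (V `\` f @^-1` V)); split => //; first by move=> y [/U0W].
split.
  by apply: clopenI => //; apply: clopenD => //; exact: clopen_homeo_preimage.
by move=> y [_ [_ nVfy]] [_ [/nVfy]].
Qed.

(** A clopen set meeting every two-point orbit of s exactly once, built greedily:
    to a partial transversal A one adds the points of a small displaced set whose
    orbit A does not meet yet.  Compactness makes finitely many steps suffice. *)
Lemma fundamental_domain s : involution s -> clopen (supp s) ->
  exists2 A, displaced A s & supp s = A `|` s @` A.
Proof.
move=> /involutionP ss cs.
pose P K := exists2 A, displaced A s & A `<=` supp s /\ K `&` supp s `<=` A `|` s @` A.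
suff [A dA [As sA]] : P setT.
  exists A => //; apply/seteqP; split=> [x sx|x [/As//|[y /As sy <-]]].
    exact: sA.
  exact/supp_homeo.
apply: (compact_union_ind compactX) => [|x].
  exists set0; last by split=> // x [].
  by split; first exact: clopen0.
have [sx|nsx] := pselect (supp s x); last first.
  have [onsx _] : clopen (~` supp s) by exact: clopenC set0 cs.
  exists (~` supp s); first exact: open_nbhs_nbhs (conj onsx nsx).
  by move=> K [A dA [As sA]]; exists A => //; split=> // y [[Ky sy|//]]; apply: sA.
have [U [Ux Us [cU dU]]] := displaced_nbhs sx (open_nbhs_nbhs (conj cs.1 sx)).
exists U; first by apply: open_nbhs_nbhs; split=> //; case: cU.
move=> K [A [cA dA] [As sA]]; exists (A `|` (U `\` (A `|` s @` A))).
  split.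
    apply: clopenU => //; apply: clopenD => //; apply: clopenU => //.
    exact: clopen_homeo_image.
  move=> y [Ay|[Uy nAy]] [Asy|[Usy nAsy]].
  - exact: (dA y).
  - by apply: nAsy; right; exists y.
  - by apply: nAy; right; exists (s y); rewrite ?ss.
  - exact: (dU y).
split=> [y [/As//|[/Us//]]|y [Ky sy]].
have [[Ay|[z Az zy]]|nAy] := pselect ((A `|` s @` A) y).
- by left; left.
- by right; exists z => //; left.
- case: Ky => [Ky|Uy]; first by case: nAy; apply: sA.
  by left; right.
Qed.

End CantorSpace.

(** * Pairing off almost all of a clopen set *)

Section MinimalSystem.
Variables (X : topologicalType) (phi : homeo X).
Hypothesis cantorX : cantor_like X.
Hypothesis minimal : forall x, dense (Orb phi x).
Implicit Types (f g h s : homeo X) (A U V W : set X).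

Let compactX : compact [set: X]. Proof. by case: cantorX. Qed.

Lemma orbit_meets x U : open U -> U !=set0 ->
  exists2 r, full_group phi r & U (r x).
Proof.
move=> oU U0; have [y [Uy [n _ nx]]] := minimal x U0 oU.
by exists (zpowg phi n); [exact: full_zpowg|rewrite nx].
Qed.

(** Two disjoint equivalent clopen sets fit in any non-empty open W: the orbit of
    a point of W returns to W at another point. *)
Lemma displaced_inside W : open W -> W !=set0 ->
  exists r U, [/\ full_group phi r, displaced U r, U !=set0,
                  U `<=` W & r @` U `<=` W].
Proof.
move=> oW [x Wx]; have [oWx Wx0] := punctured_open cantorX oW Wx.
have [r fr [Wrx rx]] := orbit_meets x oWx Wx0.
have xW : nbhs x (W `&` r @^-1` W).
  apply: filterI; first exact: open_nbhs_nbhs.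
  by apply: (@homeo_continuous _ r); apply: open_nbhs_nbhs.
have [U [Ux UW dU]] := displaced_nbhs cantorX rx xW.
exists r, U; split=> //; first by exists x.
- by move=> y /UW[].
- by move=> _ [y /UW[_ Wry] <-].
Qed.

(** The involution h pairs off a part of A, and f moves the unpaired rest of A
    into U.  By minimality the translates of U by the full group cover the space,
    and by compactness finitely many of them do, so A can be absorbed piece by
    piece.  When a new piece N, which some r moves into U, is added, its image may
    overlap the image under f of the unpaired points found so far; but the points
    of N over the overlap can then be paired with the earlier points over it,
    after which both disappear from the unpaired set.  The remaining images in U
    are disjoint, so f can be extended by r on the rest of N. *)
Lemma pairing_up_to_small A U : clopen A -> clopen U -> U !=set0 ->
  exists h f, [/\ clopen_involution phi h, supp h `<=` A, full_group phi f &
                  forall x, (A `\` supp h) x -> U (f x)].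
Proof.
move=> cA cU U0.
(* The part of A treated so far is taken to contain A `&` U from the start, with
   f the identity there; new pieces are then disjoint from U, and keeping supp f
   inside the treated part and U makes f the identity on them. *)
pose P K := clopen K /\ exists h f,
  [/\ clopen_involution phi h, supp h `<=` A `&` (K `|` U),
      full_within phi ((A `&` (K `|` U)) `|` U) f &
      forall x, (A `&` (K `|` U)) x -> ~ supp h x -> U (f x)].
suff [_ [h [f [ih sh [ff _] hf]]]] : P setT.
  exists h, f; split=> // [x /sh[]//|x [Ax nhx]].
  by apply: hf => //; split=> //; left.
apply: (compact_union_ind compactX) => [|p].
  split; first exact: clopen0.
  exists 1, 1; split.
  - split; [exact: full1|by rewrite /involution expg2 mulg1|].
    have -> : supp (1 : homeo X) = set0 by apply/seteqP; split=> y // [].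
    exact: clopen0.
  - by move=> y [].
  - exact: within1.
  - by move=> y [_ []].
have [r fr Urp] := orbit_meets p cU.1 U0.
have cV : clopen (r @^-1` U) by exact: clopen_homeo_preimage.
exists (r @^-1` U); first by apply: open_nbhs_nbhs; split=> //; case: cV.
move=> K [cK [h [f [ih sh [ff sf] hf]]]].
split; first exact: clopenU.
set V := r @^-1` U in cV *; pose AK := A `&` (K `|` U).
have cAK : clopen AK by apply: clopenI => //; apply: clopenU.
pose N := (A `&` V) `\` (K `|` U).
have cN : clopen N by apply: clopenD; [exact: clopenI|exact: clopenU].
(* q sends a point of N to the point that f moves to the same place; M is the
   part of N for which that point is still unpaired. *)
pose q := f^-1 * r.
have fq : full_group phi q by apply: fullM => //; exact: fullV.
have qN x : N x -> f (q x) = r x by rewrite homeoME homeofV.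
have nNAK x : N x -> ~ AK x by move=> [_ nKU] [].
have nNU x : N x -> ~ U x by move=> [_ nKU] Ux; apply: nKU; right.
pose M := N `&` q @^-1` (AK `\` supp h).
have cM : clopen M.
  apply: clopenI => //; apply: clopen_homeo_preimage; apply: clopenD => //.
  exact: cinv_supp ih.
have dM : displaced M q.
  by split=> // y [_ [AKq _]] [/nNAK].
have NM : clopen (N `\` M) by apply: clopenD.
have dR : displaced (N `\` M) r.
  by split=> // y [[[_ Ury] _] _] [/nNU].
have hM : supp h `&` supp (swap M q) = set0.
  rewrite supp_swap//; apply/seteqP; split=> // y [hy [[Ny _]|[z [_ [_ nhq]] zy]]].
  - by apply: (nNAK y) => //; apply: sh.
  - by apply: nhq; rewrite zy.
exists (h * swap M q), (swap (N `\` M) r * f).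
have [iM sM] := disjoint_involutionM (cinv_involution ih) (swap_involution dM) hM.
have AKV : AK `<=` A `&` ((K `|` V) `|` U).
  by move=> y [Ay [Ky|Uy]]; split=> //; [left; left|right].
have NV : N `<=` A `&` ((K `|` V) `|` U).
  by move=> y [[Ay Vy] _]; split=> //; left; right.
split.
- exact: clopen_involutionM (swap_clopen_involution fq dM) hM.
- rewrite sM supp_swap// => y [/sh/AKV//|[[/NV//]|[z [_ [/AKV qz _]] <-//]]].
- apply: withinM.
  + apply: within_swap => //; first by move=> y [/NV ? _]; left.
    by move=> _ [y [[[_ Ury] _] _] <-]; right.
  + by split=> // y /sf[/AKV|Uy]; [left|right].
- move=> y Ay; rewrite sM supp_swap// => ny; rewrite homeoME.
  have nhy : ~ supp h y by move=> hy; apply: ny; left.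
  have [AKy|nAKy] := pselect (AK y).
    have Ufy := hf y AKy nhy.
    rewrite swap_out//; first by move=> [/nNU].
    move=> [z [Nz nMz] rz]; apply: nMz; split=> //.
    have qz : q z = y by apply: (@homeo_inj _ f); rewrite qN.
    by change ((AK `\` supp h) (q z)); rewrite qz.
  have Ny : N y.
    split; last by move=> KU; apply: nAKy; split=> //; case: Ay.
    case: Ay => Ay [[Ky|Vy]|Uy] //; exfalso; apply: nAKy; split=> //; [left|right]; by [].
  have -> : f y = y.
    by apply: supp_fixed => /sf[//|]; exact: nNU.
  have nMy : ~ M y by move=> My; apply: ny; right; left.
  by rewrite swap_in//; case: Ny => -[].
Qed.

End MinimalSystem.

(** * Splitting off commutators *)

Section Compression.
Variables (X : topologicalType) (phi : homeo X).
Hypothesis cantorX : cantor_like X.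
Hypothesis minimal : forall x, dense (Orb phi x).
Implicit Types (f g h k s : homeo X) (A B C U V W : set X).

(** [swap (k(A)) g] is the conjugate of the involution [swap A f] by k. *)
Lemma swap_pair_commutator k A f g : displaced A f ->
  (forall x, A x -> k (f x) = g (k x)) ->
  swap A f * swap (k @` A) g = commutator (swap A f) k.
Proof.
move=> dA kfg; have [dk kE] := swap_conj k dA.
have -> : swap (k @` A) g = k * swap A f * k^-1.
  rewrite kE; apply/esym/eq_swap => // _ [x Ax <-].
  by rewrite !homeoME homeoVf kfg.
by rewrite /commutator (involutionV (swap_involution dA)) !mulgA.
Qed.

(** Write supp h as the disjoint union of B and h(B).  The restrictions of g to
    the orbits of B and of h(B) are conjugate by k, which acts as h on A and as
    g h g^-1 on g(A); so their product is a commutator, and what is left of g is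
    its restriction to the orbits of the points of A fixed by h. *)
Lemma split_off_commutator g h A : clopen_involution phi g -> displaced A g ->
  supp g = A `|` g @` A -> clopen_involution phi h -> supp h `<=` A ->
  exists2 c, product_of_commutators (full_within phi (supp g)) 1 c &
             g = c * swap (A `\` supp h) g.
Proof.
move=> [fg ig _] [cA dA] sg [fh ih ch] hA.
have gg := (involutionP g).1 ig; have hh := (involutionP h).1 ih.
have [B dB sh] := fundamental_domain cantorX ih ch.
have hgA x : A x -> h (g x) = g x by move=> Ax; apply: supp_fixed => /hA; exact: dA.
have BA : B `<=` A by move=> x Bx; apply: hA; rewrite sh; left.
have hBA : h @` B `<=` A by move=> x hBx; apply: hA; rewrite sh; right.
have Ag : A `<=` supp g by rewrite sg => x; left.
have cB := dB.1; have chB := clopen_homeo_image h cB.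
have dBg : displaced B g by apply: displaced_sub (conj cA dA).
pose k := h * (g * h * g^-1).
have kB x : B x -> k x = h x.
  by move=> /BA Ax; rewrite !homeoME (involutionV ig) (hgA x)// gg.
have kg x : B x -> k (g x) = g (k x).
  move=> Bx; rewrite (kB x Bx) !homeoME homeoVf hgA//.
  by apply: hBA; exists x.
have wg : full_within phi (supp g) g by split.
have wh : full_within phi (supp g) h by split=> // x /hA/Ag.
exists (commutator (swap B g) k).
  apply: product_of_commutators1; last first.
    by apply: withinM => //; apply: withinM (withinV wg); apply: withinM.
  apply: within_swap => // [x /BA/Ag//|_ [x /BA/Ag sx <-]].
  exact/supp_homeo.
rewrite -(swap_pair_commutator dBg kg).
have -> : k @` B = h @` B.
  by apply/seteqP; split=> _ [x Bx <-]; exists x => //; rewrite kB.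
have AE : A = supp h `|` (A `\` supp h) by rewrite setDUK.
rewrite {1}(involution_eq_swap ig (conj cA dA) sg) {1}AE.
have dh : displaced (supp h) g by apply: displaced_sub (conj cA dA).
rewrite swapU ?setDIK -?AE//; [|exact: clopenD].
congr (_ * _); rewrite sh swapU -?sh//; apply/seteqP; split=> // y [By [z Bz zy]].
by apply: (dB.2 z Bz); rewrite zy.
Qed.

(** With C the unpaired part of A and f(C) inside U, the exchange of C and g(C) is
    carried by k to the exchange g' of f(C) and r(f(C)), where U and r(U) are
    disjoint subsets of W.  One commutator accounts for the paired part of g, and
    a second one, [commutator (swap C g) k], for the product of [swap C g]
    and g'. *)
Lemma compress_involution g W : clopen_involution phi g -> open W ->
  W !=set0 -> W `&` supp g = set0 ->
  exists g', [/\ clopen_involution phi g', supp g' `<=` W &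
    product_of_commutators (full_within phi (supp g `|` supp g')) 2 (g * g')].
Proof.
move=> ig oW W0 Wg.
have nWg x : W x -> ~ supp g x by move=> Wx gx; suff : set0 x by []; rewrite -Wg.
have [A [cA dA] sg] := fundamental_domain cantorX (cinv_involution ig) (cinv_supp ig).
have fg := cinv_full ig.
have [r [U [fr [cU dU] U0 UW rUW]]] := displaced_inside cantorX minimal oW W0.
have [h [f [ih hA ff fAU]]] := pairing_up_to_small cantorX minimal cA cU U0.
have [c cg gE] := split_off_commutator ig (conj cA dA) sg ih hA.
set C := A `\` supp h in fAU gE.
have cC : clopen C by apply: clopenD => //; exact: cinv_supp ih.
have CA : C `<=` A by move=> x [].
have Ag : A `<=` supp g by rewrite sg => x; left.
have Cg x : C x -> supp g x by move=> /CA/Ag.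
have gCg x : C x -> supp g (g x) by move=> /Cg ?; apply/supp_homeo.
have dCg : displaced C g by apply: displaced_sub (conj cA dA).
have fCU : f @` C `<=` U by move=> _ [x /fAU ? <-].
have dCf : displaced C f by split=> // x /fAU/UW/nWg + /Cg.
have dr : displaced (f @` C) r.
  by apply: displaced_sub (conj cU dU) => //; exact: clopen_homeo_image.
have d2 : displaced (g @` C) (r * f * g^-1).
  split; first exact: clopen_homeo_image.
  move=> _ [x Cx <-] [y Cy]; rewrite !homeoME homeoVf => gy.
  by apply: (nWg (g y)); [rewrite gy; apply: rUW; exists (f x) => //; exact: fAU|exact: gCg].
have f2 : full_group phi (r * f * g^-1).
  by apply: fullM (fullV fg); exact: fullM.
pose k := swap C f * swap (g @` C) (r * f * g^-1).
have rfx x : C x -> (r * f * g^-1) (g x) = r (f x) by rewrite !homeoME homeoVf.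
have kC x : C x -> k x = f x.
  move=> Cx; rewrite homeoME (swap_out d2) ?swap_in//.
    by move=> [y Cy yx]; apply: (dA y (CA _ Cy)); rewrite yx; exact: CA.
  move=> [_ [y Cy <-]]; rewrite rfx// => yx; apply: (nWg x); last exact: Cg.
  by rewrite -yx; apply: rUW; exists (f y) => //; exact: fAU.
have kg x : C x -> k (g x) = r (k x).
  move=> Cx; have gCx : (g @` C) (g x) by exists x.
  rewrite (kC x Cx) homeoME (swap_in d2 gCx) (rfx x Cx).
  have rUfx : (r @` U) (r (f x)) by exists (f x) => //; exact: fAU.
  rewrite swap_out//; first by move=> /Cg; apply: nWg; apply: rUW.
  by move=> /fCU; apply: dU; exact: fAU.
have kCE : k @` C = f @` C.
  by apply/seteqP; split=> _ [x Cx <-]; exists x => //; rewrite kC.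
exists (swap (f @` C) r); split.
- exact: swap_clopen_involution.
- rewrite supp_swap// => x [/fCU/UW//|[y /fCU Uy <-]].
  by apply: rUW; exists y.
rewrite {2}gE -mulgA -kCE swap_pair_commutator// kCE.
apply: (@product_of_commutatorsM _ _ 1 1).
  have [a [b [Hab ->]]] := cg; exists a, b; split=> // i.
  by have [[fa sa] [fb sb]] := Hab i; split; split=> // x ?; left; [apply: sa|apply: sb].
rewrite supp_swap//; apply: product_of_commutators1.
  by apply: within_swap => // [x /Cg|_ [x /gCg gx <-]]; left.
apply: withinM; apply: within_swap => //.
- by move=> x /Cg; left.
- by move=> x; right; left.
- by move=> _ [x /gCg ? <-]; left.
- by move=> _ [_ [x Cx <-] <-]; right; right; rewrite rfx//; exists (f x) => //; exists x.
Qed.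

(** Pairing off a small clopen E inside the fundamental domain of g removes E from
    the support of the remaining factor. *)
Lemma shrink_involution g : clopen_involution phi g -> supp g !=set0 ->
  exists g' c, [/\ clopen_involution phi g', ~` supp g' !=set0,
    product_of_commutators (full_group phi) 1 c & g = c * g'].
Proof.
move=> ig g0.
have [A [cA dA] sg] := fundamental_domain cantorX (cinv_involution ig) (cinv_supp ig).
have A0 : A !=set0 by case: g0 => x; rewrite sg => -[Ax|[y Ay _]]; [exists x|exists y].
have [r [E [fr dE [e Ee] EA rEA]]] := displaced_inside cantorX minimal cA.1 A0.
have sh := supp_swap dE.
have hA : supp (swap E r) `<=` A by rewrite sh => x [/EA|/rEA].
have ih := swap_clopen_involution fr dE.
have [c cg gE] := split_off_commutator ig (conj cA dA) sg ih hA.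
have dA' : displaced (A `\` supp (swap E r)) g.
  apply: displaced_sub (conj cA dA); last by move=> x [].
  by apply: clopenD => //; exact: cinv_supp ih.
exists (swap (A `\` supp (swap E r)) g), c; split=> //.
- exact: swap_clopen_involution (cinv_full ig) dA'.
- exists e; rewrite supp_swap// => -[[_]|[y [Ay _] ye]]; first by rewrite sh; apply; left.
  by apply: (dA y Ay); rewrite ye; apply: EA.
- have [a [b [Hab ->]]] := cg; exists a, b; split=> // i.
  by have [[fa _] [fb _]] := Hab i.
Qed.

End Compression.

(** * Gluing infinitely many homeomorphisms *)

Section Gluing.
Variables (X : topologicalType) (phi : homeo X) (Y : nat -> set X).
Hypothesis openY : forall n, open (Y n).
Hypothesis disjY : forall m n x, Y m x -> Y n x -> m = n.
(* Continuity of a glued map at a point of no piece: a piece that comes near the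
   point is contained in a small neighbourhood of it. *)
Hypothesis smallY : forall x, (forall n, ~ Y n x) ->
  forall V, nbhs x V -> nbhs x [set y | forall n, Y n y -> Y n `<=` V].
Implicit Types (f g : nat -> homeo X) (F G : homeo X).

Record is_glue f F : Prop := IsGlue {
  glue_supp : forall n, supp (f n) `<=` Y n;
  glue_in : forall n x, Y n x -> F x = f n x;
  glue_out : forall x, (forall n, ~ Y n x) -> F x = x }.

Definition glue_fun f x :=
  if pselect (exists n, Y n x) is left Yx then f (projT1 (cid Yx)) x else x.

Let piecesE x : (exists n, Y n x) \/ (forall n, ~ Y n x).
Proof.
by have [|nY] := pselect (exists n, Y n x); [left|right=> n Yx; apply: nY; exists n].
Qed.

Lemma glue_fun_in f n x : Y n x -> glue_fun f x = f n x.
Proof.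
rewrite /glue_fun => Yx; case: pselect => [e|[]]; last by exists n.
by case: cid => m Ymx /=; rewrite (disjY Ymx Yx).
Qed.

Lemma glue_fun_out f x : (forall n, ~ Y n x) -> glue_fun f x = x.
Proof. by rewrite /glue_fun => nY; case: pselect => // -[n Yx]; case: (nY n). Qed.

Lemma glue_fun_continuous f : (forall n, supp (f n) `<=` Y n) ->
  continuous (glue_fun f).
Proof.
move=> fY x; rewrite /continuous_at; have [[n Yx]|nY] := piecesE x.
  rewrite (glue_fun_in f Yx); apply: cvg_trans (@homeo_continuous _ (f n) x).
  apply: near_eq_cvg; apply: filterS (open_nbhs_nbhs (conj (openY n) Yx)) => y Yy.
  by rewrite (glue_fun_in f Yy).
rewrite (glue_fun_out f nY) => V xV.
apply: filterS (filterI xV (smallY nY xV)) => y [Vy YV] /=.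
have [[n Yy]|nYy] := piecesE y; last by rewrite /= glue_fun_out.
by rewrite /= (glue_fun_in f Yy); apply: (YV n Yy); apply: within_preserve Yy.
Qed.

Lemma glue_exists f : (forall n, supp (f n) `<=` Y n) -> exists F, is_glue f F.
Proof.
have K (u v : nat -> homeo X) : (forall n, supp (u n) `<=` Y n) -> (forall n x, v n (u n x) = x) ->
    cancel (glue_fun u) (glue_fun v).
  move=> uY uv x; have [[n Yx]|nY] := piecesE x; last by rewrite !glue_fun_out.
  by rewrite (glue_fun_in u Yx) (glue_fun_in v (within_preserve (uY n) Yx)).
move=> fY; pose f' n := (f n)^-1.
have f'Y n : supp (f' n) `<=` Y n.
  by move=> x /supp_homeoV/fY.
exists (Homeo (glue_fun_continuous fY) (glue_fun_continuous f'Y)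
              (K _ _ fY (fun n => homeoVf (f n))) (K _ _ f'Y (fun n => homeofV (f n)))).
by split=> //= [n x|x]; [exact: glue_fun_in|exact: glue_fun_out].
Qed.

Lemma is_glue1 : is_glue (fun=> 1) 1.
Proof. by split=> // n x []. Qed.

Lemma is_glueM f g F G : is_glue f F -> is_glue g G ->
  is_glue (fun n => f n * g n) (F * G).
Proof.
move=> [fY fin fout] [gY gin gout]; split=> [n x|n x Yx|x nY].
- by move=> /supp_homeoM[/fY|/gY].
- by rewrite !homeoME (gin n)// (fin n)//; apply: within_preserve Yx.
- by rewrite homeoME gout// fout.
Qed.

Lemma is_glueV f F : is_glue f F -> is_glue (fun n => (f n)^-1) F^-1.
Proof.
move=> [fY fin fout].
have fVY n : supp (f n)^-1 `<=` Y n by move=> x /supp_homeoV/fY.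
split=> // [n x Yx|x nY]; apply: (@homeo_inj _ F); rewrite homeofV.
- by rewrite (fin n) ?homeofV//; apply: within_preserve Yx.
- by rewrite fout.
Qed.

Lemma is_glue_prod (I : Type) (r : seq I) (f : I -> nat -> homeo X) (F : I -> homeo X) :
  (forall i, is_glue (f i) (F i)) ->
  is_glue (fun n => \prod_(i <- r) f i n) (\prod_(i <- r) F i).
Proof.
move=> fF; elim: r => [|i r IHr].
  by rewrite big_nil; under eq_fun do rewrite big_nil; exact: is_glue1.
by rewrite big_cons; under eq_fun do rewrite big_cons; exact: is_glueM.
Qed.

Lemma full_glue f F : (forall n, full_group phi (f n)) -> is_glue f F ->
  full_group phi F.
Proof.
move=> ff [_ fin fout]; apply: full_local => x; have [[n Yx]|nY] := piecesE x.
- by exists (f n); last exact: fin.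
- by exists 1; [exact: full1|rewrite fout].
Qed.

(** Gluing is a homomorphism, so the factors can be glued one by one. *)
Lemma glue_product_of_commutators k t :
  (forall n, product_of_commutators (full_within phi (Y n)) k (t n)) ->
  exists2 F, is_glue t F & product_of_commutators (full_group phi) k F.
Proof.
move=> /choice[a] /choice[b tE].
have glued (u : nat -> 'I_k -> homeo X) :
    (forall n i, full_within phi (Y n) (u n i)) ->
    exists U : 'I_k -> homeo X, forall i, is_glue (u^~ i) (U i) /\ full_group phi (U i).
  move=> wu; suff /choice[U UP] : forall i, exists V,
      is_glue (u^~ i) V /\ full_group phi V by exists U.
  move=> i; have [V uV] := glue_exists (fun n => (wu n i).2).
  by exists V; split=> //; apply: full_glue uV => n; case: (wu n i).
have [A AP] := glued a (fun n i => ((tE n).1 i).1).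
have [B BP] := glued b (fun n i => ((tE n).1 i).2).
exists (\prod_(i < k) commutator (A i) (B i)); last first.
  by exists A, B; split=> // i; split; [case: (AP i)|case: (BP i)].
have -> : t = fun n => \prod_(i < k) commutator (a n i) (b n i).
  by apply/funext => n; case: (tE n).
apply: is_glue_prod => i; have [aA _] := AP i; have [bB _] := BP i.
by do 2![apply: is_glueM (is_glueV _) => //]; apply: is_glueM.
Qed.

End Gluing.

(** All but finitely many pieces lie in a given neighbourhood of p, and a point x
    outside the pieces has a neighbourhood that misses the others, which are
    closed.  For x different from p, one shrinks it further to miss a
    neighbourhood of p, hence all the pieces. *)
Lemma shrinking_small (X : topologicalType) (Y : nat -> set X) (p : X) :
  hausdorff_space X -> (forall n, closed (Y n)) ->
  (forall V, nbhs p V -> exists N, forall n, (N <= n)%N -> Y n `<=` V) ->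
  forall x, (forall n, ~ Y n x) ->
  forall V, nbhs x V -> nbhs x [set y | forall n, Y n y -> Y n `<=` V].
Proof.
move=> hX cY shr x nY V xV.
have avoid N : nbhs x [set y | forall n, (n < N)%N -> ~ Y n y].
  elim: N => [|N IHN]; first by apply: filterS filterT.
  have xN : nbhs x (~` Y N).
    by apply: open_nbhs_nbhs; split; [exact: closed_openC|exact: nY].
  apply: filterS (filterI IHN xN) => y [yN nYy] n; rewrite ltnS leq_eqVlt.
  by case/predU1P => [->//|]; exact: yN.
have [xp|/eqP xp] := eqVneq x p.
  have [N NV] := shr V (eq_ind x (fun q => nbhs q V) xV p xp).
  apply: filterS (avoid N) => y yN n Yy; apply: NV.
  by rewrite leqNgt; apply/negP => /yN.
have /eqP xp' := xp; move: hX; rewrite open_hausdorff => /(_ x p xp').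
move=> [[A B] /= [/set_mem Ax /set_mem Bp] [oA oB /eqP AB]].
have [N NB] := shr B (open_nbhs_nbhs (conj oB Bp)).
apply: filterS (filterI (avoid N) (open_nbhs_nbhs (conj oA Ax))) => y [yN Ay] n Yy.
have [/yN//|/NB YB] := ltnP n N.
by suff : set0 y by []; rewrite -AB; split=> //; apply: YB.
Qed.

(** * Telescoping along a sequence of involutions *)

Section Telescoping.
Variables (X : topologicalType) (phi : homeo X).
Hypothesis cantorX : cantor_like X.
Hypothesis minimal : forall x, dense (Orb phi x).
Implicit Types (g s : nat -> homeo X) (V : set X) (p : X).

Definition compressing p s :=
  [/\ forall n, clopen_involution phi (s n),
      forall m n x, supp (s m) x -> supp (s n) x -> m = n,
      forall V, nbhs p V -> exists N, forall n, (N <= n)%N -> supp (s n) `<=` V &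
      forall n, product_of_commutators
        (full_within phi (supp (s n) `|` supp (s n.+1))) 2 (s n * s n.+1)].

Lemma compressing_shift p s : compressing p s -> compressing p (fun n => s n.+1).
Proof.
move=> [cs ds shr ts]; split=> // [m n x sm sn|V /shr[N NV]].
  by have [] := ds _ _ _ sm sn.
by exists N => n Nn; apply: NV; apply: leqW.
Qed.

(** The infinite product of all the s_n, grouped as (s_0 s_1)(s_2 s_3)...: the
    pairs of consecutive supports are disjoint pieces shrinking to p, on each of
    which the product is a product of two commutators. *)
Lemma compressing_product p s : compressing p s ->
  exists F, [/\ product_of_commutators (full_group phi) 2 F,
    forall n x, supp (s n) x -> F x = s n x &
    forall x, (forall n, ~ supp (s n) x) -> F x = x].
Proof.
move=> [cs ds shr ts].
pose Y n := supp (s n.*2) `|` supp (s n.*2.+1).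
pose t n := s n.*2 * s n.*2.+1.
have cY n : clopen (Y n) by apply: clopenU; apply: cinv_supp (cs _).
have disjY m n x : Y m x -> Y n x -> m = n.
  have halfE (k : nat) : (Y k x) -> exists2 j, k = j./2 & supp (s j) x.
    by case=> sx; [exists k.*2|exists k.*2.+1] => //=; rewrite ?doubleK ?uphalf_double.
  by move=> /halfE[i -> si] /halfE[j -> sj]; rewrite (ds _ _ _ si sj).
have smallY := @shrinking_small X Y p _ (fun n => (cY n).2).
have [||F [_ Fin Fout] cF] :=
  @glue_product_of_commutators X phi Y (fun n => (cY n).1) disjY _ 2 t.
- apply: smallY; first by case: cantorX.
  move=> V /shr[N NV]; exists N => n Nn x.
  have Nn2 : (N <= n.*2)%N by rewrite -addnn; apply: leq_trans Nn (leq_addr _ _).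
  by case; apply: NV => //; apply: leqW.
- by move=> n; apply: ts.
exists F; split=> // [n x sx|x nsx]; last first.
  by apply: Fout => n [] /nsx.
have [m [nE|nE]] : exists m, n = m.*2 \/ n = m.*2.+1.
  exists n./2; case: (odd n) (odd_double_half n) => nE; [right|left];
    by rewrite -[LHS]nE.
- rewrite nE in sx *; rewrite (Fin m); last by left.
  by rewrite homeoME (@supp_fixed _ (s m.*2.+1))// => /(ds _ _ _ sx)/n_Sn.
- rewrite nE in sx *; rewrite (Fin m); last by right.
  rewrite homeoME supp_fixed// => sx'; apply: (@n_Sn m.*2); apply: ds sx' _.
  exact/supp_homeo.
Qed.

(** The infinite product of the s_n with n >= 0 times that of the s_n with n >= 1
    is s_0, because the s_n are commuting involutions. *)
Lemma compressing_head p s : compressing p s ->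
  product_of_commutators (full_group phi) 4 (s 0%N).
Proof.
move=> cs; have [_ ds _ _] := cs; have [F [cF Fin Fout]] := compressing_product cs.
have [G [cG Gin Gout]] := compressing_product (compressing_shift cs).
suff -> : s 0%N = F * G by exact: (product_of_commutatorsM cF cG).
apply: homeoP => x; rewrite homeoME.
have [[n sx]|ns] := pselect (exists n, supp (s n) x); last first.
  have nsx n : ~ supp (s n) x by move=> sx; apply: ns; exists n.
  by rewrite Gout ?Fout ?supp_fixed// => n; apply: nsx.
case: n sx => [|n] sx.
  by rewrite Gout ?(Fin 0%N)// => n /(ds _ _ _ sx).
rewrite (Gin n)// (Fin n.+1); last exact/supp_homeo.
have [[_ /involutionP ss _] _ _ _] := (let: And4 c _ _ _ := cs in And4 (c n.+1) I I I).
by rewrite ss supp_fixed// => /(ds _ _ _ sx).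
Qed.

(** The involutions are built along decreasing clopen neighbourhoods V of p: the
    next involution is supported in the shell between V and a strictly smaller
    neighbourhood V', which is non-empty because p is not isolated. *)
Lemma compressing_exists (g0 : homeo X) p (N : nat -> set X) :
  clopen_involution phi g0 -> ~ supp g0 p -> (forall n, nbhs p (N n)) ->
  (forall V, nbhs p V -> exists n, N n `<=` V) ->
  exists2 s, s 0%N = g0 & compressing p s.
Proof.
move=> ig np Np Nbase.
pose state : Type := (nat * homeo X * set X)%type.
pose inv (q : state) := [/\ clopen_involution phi q.1.2, clopen q.2, q.2 p &
                            q.2 `&` supp q.1.2 = set0].
(* The condition inv q is part of the relation, so that a successor exists for
   every state and dependent choice applies to the plain type of states. *)
pose step (q q' : state) := inv q -> [/\ inv q', q'.1.1 = q.1.1.+1,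
  q'.2 `<=` q.2 `&` N q.1.1, supp q'.1.2 `<=` q.2 &
  product_of_commutators (full_within phi (supp q.1.2 `|` supp q'.1.2)) 2
    (q.1.2 * q'.1.2)].
have nextq (q : state) : {q' | step q q'}.
  apply: cid; have [|nq] := pselect (inv q); last by exists q => /nq.
  case: q => -[n s] V /= [cs cV Vp Vs].
  have [oVp [y [Vy yp]]] := punctured_open cantorX cV.1 Vp.
  have pV : nbhs p (V `&` N n `&` ~` [set y]).
    apply: filterI; first by apply: filterI => //; apply: open_nbhs_nbhs; case: cV.
    have [U [cU Up nUy]] : exists U, [/\ clopen U, U p & ~ U y].
      by case: cantorX => _ _ _; apply; apply/eqP => /esym.
    apply: filterS (open_nbhs_nbhs (conj cU.1 Up)) => z Uz /= zy.
    by apply: nUy; rewrite -zy.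
  have [V' [cV' V'p V'V]] := clopen_nbhs cantorX pV.
  have [|||s' [cs' s'V ss']] := compress_involution cantorX minimal (W := V `\` V') cs.
  - by have [] : clopen (V `\` V') by apply: clopenD.
  - by exists y; split=> // /V'V[_]; apply.
  - by apply/seteqP; split=> // x [[Vx _] sx]; rewrite -Vs.
  exists (n.+1, s', V') => _; split=> //=.
  - by split=> //=; apply/seteqP; split=> // x [V'x /s'V[_]].
  - by move=> x /V'V[].
  - by move=> x /s'V[].
have [V0 [cV0 V0p V0g]] : exists V, [/\ clopen V, V p & V `<=` ~` supp g0].
  apply: clopen_nbhs => //; apply: open_nbhs_nbhs; split=> //.
  by have [] : clopen (~` supp g0) by exact: clopenC set0 (cinv_supp ig).
have [q [q0 qS]] := dependent_choice nextq (0%N, g0, V0).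
have invq n : inv (q n).
  elim: n => [|n /qS[]//]; rewrite q0; split=> //=.
  by apply/seteqP; split=> // x [/V0g].
have rk n : (q n).1.1 = n.
  by elim: n => [|n IHn]; [rewrite q0|have [_ -> _ _ _] := qS n (invq n); rewrite IHn].
have decV m n : (m <= n)%N -> (q n).2 `<=` (q m).2.
  move=> /subnKC <-; elim: (n - m)%N => [|k IHk]; first by rewrite addn0.
  by rewrite addnS; have [_ _ dV _ _] := qS _ (invq (m + k)%N); move=> x /dV[/IHk].
have suppV m n : (m < n)%N -> supp (q n).1.2 `<=` (q m).2.
  case: n => // n mn; have [_ _ _ sV _] := qS n (invq n).
  by move=> x /sV; apply: decV.
have disj m n x : (m < n)%N -> supp (q m).1.2 x -> ~ supp (q n).1.2 x.
  move=> mn sm /(suppV _ _ mn) Vm; have [_ _ _ Vs] := invq m.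
  by suff : set0 x by []; rewrite -Vs.
exists (fun n => (q n).1.2); first by rewrite q0.
split=> [n|m n x sm sn|V /Nbase[n nV]|n].
- by case: (invq n).
- by have [mn|mn|//] := ltngtP m n; [case: (disj m n x)|case: (disj n m x)].
- exists n.+2 => m nm x /(suppV n.+1 m nm).
  by have [_ _ dV _ _] := qS n (invq n); move=> /dV[_]; rewrite rk => /nV.
- by case: (qS n (invq n)).
Qed.

End Telescoping.

Section MetricBase.
Import Order.TTheory Num.Theory.

Lemma metric_nbhs_base (R : realType) (X : metricType R) (p : X) :
  exists2 N : nat -> set X, forall n, nbhs p (N n) &
    forall V, nbhs p V -> exists n, N n `<=` V.
Proof.
exists (fun n => ball p (n.+1%:R^-1)%R) => [n|V].
  by apply: nbhsx_ballx; rewrite invr_gt0 ltr0Sn.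
move=> /nbhs_ballP[e /= e0 eV]; exists (Num.bound (e^-1)%R) => y py.
apply: eV; apply: le_ball py; rewrite -[leRHS]GRing.invrK.
rewrite lef_pV2 ?posrE ?invr_gt0 ?ltr0Sn//.
apply/ltW/(lt_le_trans (archi_boundP _)); first by rewrite invr_ge0 ltW.
by rewrite ler_nat.
Qed.

End MetricBase.

Theorem corollary4p8 (R : realType) (X : metricType R) (phi : homeo X)
    (hphi : cantor_minimal_system phi)
    (g : homeo X) (hg : full_group phi g)
    (hinv : involution g) (hsupp : clopen (supp g)) :
  product_of_commutators (full_group phi) 10 g.
Proof.
have [[_ cantorX] minimal] := hphi.
have ig : clopen_involution phi g by [].
have pad n x : product_of_commutators (full_group phi) n x ->
    (n <= 10)%N -> product_of_commutators (full_group phi) 10 x.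
  move=> cx n10; rewrite -(subnKC n10) -[x]mulg1.
  by apply: product_of_commutatorsM => //; apply/product_of_commutators_one/full1.
have [g0|ng0] := pselect (supp g !=set0); last first.
  apply: (pad 0%N) => //; have -> : g = 1.
    by apply: homeoP => x; apply: supp_fixed => gx; apply: ng0; exists x.
  exact/product_of_commutators_one/full1.
have [g' [c [ig' [p np] cc ->]]] := shrink_involution cantorX minimal ig g0.
have [N Np Nbase] := metric_nbhs_base p.
have [s s0 cs] := compressing_exists cantorX minimal ig' np Np Nbase.
apply: (pad 5%N) => //; apply: (product_of_commutatorsM cc).
by rewrite -s0; apply: compressing_head cs.
Qed.
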